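(* Let $h\ge 2$ and $n\ge 1$ be integers and let $H$ be an $h$-uniform hypergraph. If $H$ is $n$-e.c., then for each vertex $v\in V(H)$, the hypergraphs $H-v$ and $H[N(v)]$ are $(n-1)$-e.c.
   Context: A hypergraph $H=(V,E)$ consists of a finite vertex set $V$ and a collection $E$ of subsets of $V$ (edges); it is $h$-uniform if every edge has exactly $h$ vertices. For a positive integer $n$, an $h$-uniform hypergraph $H$ is $n$-existentially closed ($n$-e.c.) if for every set $S\subseteq V(H)$ with $|S|=n$ and every $T\subseteq S$, there is a set $X\subseteq V(H)\setminus S$ with $|X|=h-1$ such that $X\cup\{z\}$ is an edge of $H$ for every $z\in T$ and $X\cup\{s\}$ is not an edge of $H$ for every $s\in S\setminus T$. For $Y\subseteq V(H)$, the induced subgraph $H[Y]$ is the hypergraph with vertex set $Y$ whose edges are the edges of $H$ contained in $Y$; $H-v$ denotes $H[V(H)\setminus\{v\}]$. The neighbourhood $N(v)$ of a vertex $v$ is the set of vertices that occur together with $v$ in at least one edge of $H$. *)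

(* Defs.v *)
From mathcomp Require Import all_boot.

Set Implicit Arguments.
Unset Strict Implicit.
Unset Printing Implicit Defensive.

(* The vertex set is a subset of an ambient finite type [U], so that [H] and
   its induced subgraphs live in the same type. *)
Record hypergraph (U : finType) := Hypergraph {
  vertices : {set U};
  edges : {set {set U}};
  edges_sub : forall e, e \in edges -> e \subset vertices
}.

Definition uniform (U : finType) (h : nat) (H : hypergraph U) : Prop :=
  forall e, e \in edges H -> #|e| = h.

(* Uniformity is a conjunct because the notion only makes sense for [h]-uniform
   hypergraphs.  [n = 0] is allowed: then [S] and [T] are empty and the condition
   asks for some (h-1)-subset of the vertex set. *)
Definition existentially_closed (U : finType) (h n : nat) (H : hypergraph U)
    : Prop :=
  uniform h H /\
  forall S T : {set U}, S \subset vertices H -> #|S| = n -> T \subset S ->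
  exists X : {set U},
    [/\ X \subset vertices H :\: S,
        #|X| = h.-1,
        forall z, z \in T -> X :|: [set z] \in edges H
      & forall s, s \in S :\: T -> X :|: [set s] \notin edges H].

Lemma induced_subproof (U : finType) (H : hypergraph U) (Y : {set U}) e :
  e \in [set e in edges H | e \subset Y] -> e \subset Y.
Proof. by rewrite inE => /andP[]. Qed.

(* Meant for [Y \subset vertices H]. *)
Definition induced (U : finType) (H : hypergraph U) (Y : {set U})
    : hypergraph U :=
  Hypergraph (@induced_subproof U H Y).

Definition del_vertex (U : finType) (H : hypergraph U) (v : U) : hypergraph U :=
  induced H (vertices H :\ v).

(* A vertex is not its own neighbour. *)
Definition neighbourhood (U : finType) (H : hypergraph U) (v : U) : {set U} :=
  [set u in vertices H |
    (u != v) && [exists e in edges H, (v \in e) && (u \in e)]].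

(* Main.v *)
Require Import Defs.
From mathcomp Require Import all_boot.

(** Spend one of the [n.+1] vertices on [v]: an [S] of size [n] inside [Y] misses [v], and the [X]
    obtained for [v |: S] avoids both. Once [X] lies in [Y], each [X :|: [set z]] with [z] in [S]
    also does, so it is an edge of [induced H Y] exactly when it is one of [H]. The side on which
    [v] is put decides which [Y] contains [X]. *)

(* Apply the n-e.c. property to [v |: S]: taking [A = set0] leaves [X :|: [set v]]
   a non-edge, taking [A = [set v]] makes it an edge, which forces [X] into the
   neighbourhood of [v]. *)
Lemma induced_existentially_closed (U : finType) (h n : nat)
    (H : hypergraph U) (v : U) (A Y : {set U}) :
  existentially_closed h n.+1 H -> v \in vertices H ->
  A \subset [set v] -> Y \subset vertices H :\ v ->
  (forall X : {set U}, X \subset vertices H :\ v ->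
     (forall z, z \in A -> X :|: [set z] \in edges H) -> X \subset Y) ->
  existentially_closed h n (induced H Y).
Proof.
move=> [unifH ecH] v_in sAv sYV XsubY; split.
  by move=> e; rewrite inE => /andP[/unifH].
move=> S T /= sSY cardS sTS.
have vNS : v \notin S.
  by apply/negP => /(subsetP (subset_trans sSY sYV)); rewrite !inE eqxx.
have [||| X [sXV cardX edgeX nedgeX]] := ecH (v |: S) (A :|: T).
- rewrite subUset sub1set v_in.
  exact: subset_trans sSY (subset_trans sYV (subsetDl _ _)).
- by rewrite cardsU1 vNS cardS.
- exact: setUSS.
have sXY : X \subset Y.
  apply: XsubY => [|z zA]; last by apply: edgeX; rewrite inE zA.
  exact: subset_trans sXV (setDS _ (subsetUl _ _)).
exists X; split=> //.
- apply/subsetP => x xX; rewrite inE (subsetP sXY _ xX) andbT.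
  by move/subsetP/(_ _ xX): sXV; rewrite !inE negb_or => /andP[/andP[]].
- move=> z zT; rewrite inE edgeX ?inE ?zT ?orbT //=.
  by rewrite subUset sXY sub1set (subsetP sSY) ?(subsetP sTS).
- move=> s; rewrite inE => /andP[sNT sS].
  rewrite inE negb_and nedgeX // !inE negb_or sNT sS orbT !andbT.
  (* What remains is that [s] is not in [A]: otherwise [s = v], yet [s] is in [S]. *)
  by apply: contra vNS => /(subsetP sAv) /set1P <-.
Qed.

Theorem theorem5 (U : finType) (h n : nat) (H : hypergraph U)
    (h_ge2 : 2 <= h) (n_ge1 : 1 <= n) (H_uniform : uniform h H)
    (H_ec : existentially_closed h n H) (v : U) (v_in : v \in vertices H) :
  existentially_closed h (n - 1) (del_vertex H v) /\
  existentially_closed h (n - 1) (induced H (neighbourhood H v)).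
Proof.
case: n n_ge1 H_ec => // n _ H_ec; rewrite subn1 /=; split.
  (* Here [Y] is all of [vertices H :\ v], so nothing has to be asked of [v]. *)
  apply: (induced_existentially_closed _ _ _ _ _ set0 _ H_ec v_in) => //.
  exact: sub0set.
apply: (induced_existentially_closed _ _ _ _ _ [set v] _ H_ec v_in) => //.
  by apply/subsetP => u; rewrite !inE => /and3P[-> ->].
move=> X sXV edgeX; apply/subsetP => u uX.
move/subsetP/(_ _ uX): sXV; rewrite !inE => /andP[-> ->] /=.
(* This single edge makes every vertex of [X] a neighbour of [v]. *)
apply/existsP; exists (X :|: [set v]).
by rewrite edgeX ?inE ?eqxx ?uX ?orbT.
Qed.
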